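(* Let $a_2,a_3$ be integers with $1<a_2<a_3$ and $A=\{1,a_2,a_3\}$. Let $n$ and $p\ge 0$ be integers such that $SG(A,n,p)$ is a stride generator. If $SG(A,n,p)$ has a non-canonical break $y$ with break order $q$, then $n+q\le a_2$.
   Context: For integers $n$ and $i\ge 0$, an integer $x$ has an $n$-generation of order $i$ if there are integers $c_1,c_2\ge 0$ with $x+ia_3=c_2a_2+c_1$ and $c_1+c_2\le n+i$. For integers $n$ and $p\ge0$, $SG(A,n,p)$ is a stride generator if: (A) every integer $0\le x<a_3$ has an $n$-generation of some order $\le p$; (B) at least one integer $0\le x<a_3$ has no $n$-generation of order $<p$; (C) at least one integer $0\le y<a_3$ has no $(n-1)$-generation of any order $\le p+1$. Any $0\le y<a_3$ satisfying (C) is called a break. A break $y$ is canonical if there is no integer $j\ge 0$ with $y+ja_3=c_2a_2+c_1$, $c_1,c_2\ge 0$, $c_1+c_2\le (n-1)+j$; otherwise its break order is the smallest such $j$. *)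

(* Defs.v *)
From Stdlib Require Import ZArith Lia.
Open Scope Z_scope.

Definition has_gen (a2 a3 n i x : Z) : Prop :=
  exists c1 c2 : Z, 0 <= c1 /\ 0 <= c2 /\
    x + i * a3 = c2 * a2 + c1 /\ c1 + c2 <= n + i.

Definition is_break (a2 a3 n p y : Z) : Prop :=
  0 <= y < a3 /\ forall i, 0 <= i <= p + 1 -> ~ has_gen a2 a3 (n - 1) i y.

Definition stride_generator (a2 a3 n p : Z) : Prop :=
  0 <= p /\
  (forall x, 0 <= x < a3 -> exists i, 0 <= i <= p /\ has_gen a2 a3 n i x) /\
  (exists x, 0 <= x < a3 /\ forall i, 0 <= i < p -> ~ has_gen a2 a3 n i x) /\
  (exists y, is_break a2 a3 n p y).

Definition canonical_break (a2 a3 n y : Z) : Prop :=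
  ~ exists j, 0 <= j /\ has_gen a2 a3 (n - 1) j y.

Definition break_order (a2 a3 n y q : Z) : Prop :=
  0 <= q /\ has_gen a2 a3 (n - 1) q y /\
  forall j, 0 <= j < q -> ~ has_gen a2 a3 (n - 1) j y.

(* Main.v *)
Require Import Defs.
From Stdlib Require Import ZArith Lia List FinFun.
Open Scope Z_scope.

(** Greedily, [x] needs [coin_count a2 x] coins from [{1, a2}], so generations of
    [x] compare [coin_count a2 (x + i * a3) - i] with [n]; modulo [a2 - 1] this
    quantity is [x + i (a3 - 1)], a rotation orbit.  Covering [y + 1] and
    [y + a2] forces [y >= a3 - a2] and some [i1 <= p] (or [i1 = -1]) with
    [a2 | y + 1 + i1 a3].  Read from [i1], with [I = i1 + 1], [T = q - i1] and
    slack [c = n - (y + 1 + i1 a3) / a2 + i1], the break conditions say that in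
    Z/(a2 - 1) the multiples [j (a3 - 1)] avoid [[0, c]] for [-I < j < T],
    [j <> 0], and that [T (a3 - 1)] is the first return, to some
    [w] in [[1, c]].  For [I >= 2], packing disjoint intervals of
    lengths [w], [c + 1], [1] at the points with [j < 0], [j = 0], [j > 0] gives
    [c + (I - 1) w + T < a2], while [floor (I a3 / a2)] grows by at
    most [w] per step; together these give
    [n + q = c + floor (I a3 / a2) + T <= a2]. *)

(** * Greedy coin counts for the denominations 1 and [a] *)

Definition coin_count (a x : Z) : Z := x / a + x mod a.

Lemma coin_count_eq (a c1 c2 : Z) :
  0 <= c1 < a -> coin_count a (c2 * a + c1) = c2 + c1.
Proof.
  intros H. unfold coin_count.
  rewrite (Z.add_comm (c2 * a)), Z.div_add, Z.mod_add by lia.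
  rewrite Z.div_small, Z.mod_small by lia. lia.
Qed.

(** If the residues overflow, a carry trades [a] unit coins for one coin [a], saving [a - 1]; this
    forces both residues to be nonzero. *)
Lemma coin_count_add (a x y : Z) : 1 < a ->
  coin_count a (x + y) = coin_count a x + coin_count a y \/
  y mod a <> 0 /\
  coin_count a (x + y) = coin_count a x + coin_count a y - (a - 1).
Proof.
  intros Ha.
  pose proof (Z.div_mod x a ltac:(lia)) as Dx.
  pose proof (Z.div_mod y a ltac:(lia)) as Dy.
  pose proof (Z.mod_pos_bound x a ltac:(lia)) as Bx.
  pose proof (Z.mod_pos_bound y a ltac:(lia)) as By.
  destruct (Z_lt_le_dec (x mod a + y mod a) a) as [L | L].
  - left.
    replace (x + y) with ((x / a + y / a) * a + (x mod a + y mod a)) by lia.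
    rewrite coin_count_eq by lia. unfold coin_count. lia.
  - right. split; [lia |].
    replace (x + y) with ((x / a + y / a + 1) * a + (x mod a + y mod a - a)) by lia.
    rewrite coin_count_eq by lia. unfold coin_count. lia.
Qed.

Lemma coin_count_pred (a x : Z) : 1 < a ->
  x mod a <> 0 -> coin_count a (x - 1) = coin_count a x - 1.
Proof.
  intros Ha Hx.
  pose proof (Z.div_mod x a ltac:(lia)) as Dx.
  pose proof (Z.mod_pos_bound x a ltac:(lia)) as Bx.
  replace (x - 1) with (x / a * a + (x mod a - 1)) by lia.
  rewrite coin_count_eq by lia. unfold coin_count. lia.
Qed.

Lemma coin_count_pred_ge (a x : Z) : 1 < a ->
  coin_count a x - 1 <= coin_count a (x - 1).
Proof.
  intros Ha.
  assert (E1 : coin_count a 1 = 1) by (apply (coin_count_eq a 1 0); lia).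
  destruct (coin_count_add a (x - 1) 1 Ha) as [E | [_ E]];
    replace (x - 1 + 1) with x in E by lia; lia.
Qed.

Lemma coin_count_shift (a k x : Z) : 1 < a ->
  coin_count a (k * a + x) = k + coin_count a x.
Proof.
  intros Ha. unfold coin_count.
  rewrite (Z.add_comm (k * a)), Z.div_add, Z.mod_add by lia. lia.
Qed.

(** Complementing the last base-[a] digit needs no borrow, so digit and quotient reflect
    separately. *)
Lemma coin_count_reflect (a k x : Z) : 1 < a ->
  coin_count a (k * a - 1 - x) = k + a - 2 - coin_count a x.
Proof.
  intros Ha.
  pose proof (Z.div_mod x a ltac:(lia)) as Dx.
  pose proof (Z.mod_pos_bound x a ltac:(lia)) as Bx.
  replace (k * a - 1 - x)
    with ((k - 1 - x / a) * a + (a - 1 - x mod a)) by lia.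
  rewrite coin_count_eq by lia. unfold coin_count. lia.
Qed.

Lemma coin_count_cong (a x : Z) : 1 < a -> (a - 1 | coin_count a x - x).
Proof.
  intros Ha. exists (- (x / a)). unfold coin_count.
  pose proof (Z.div_mod x a ltac:(lia)). lia.
Qed.

(** Greedy is optimal: exchanging [a2] unit coins for one coin [a2] never increases the number of
    coins. *)
Lemma has_gen_coin_count (a2 a3 n i x : Z) : 1 < a2 -> 0 <= x + i * a3 ->
  (has_gen a2 a3 n i x <-> coin_count a2 (x + i * a3) <= n + i).
Proof.
  intros Ha Hx. split.
  - intros (c1 & c2 & H1 & H2 & E & L). rewrite E, coin_count_shift by lia.
    unfold coin_count.
    pose proof (Z.div_mod c1 a2 ltac:(lia)).
    pose proof (Z.div_pos c1 a2 ltac:(lia) ltac:(lia)). nia.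
  - intros L.
    pose proof (Z.div_mod (x + i * a3) a2 ltac:(lia)).
    pose proof (Z.mod_pos_bound (x + i * a3) a2 ltac:(lia)).
    pose proof (Z.div_pos (x + i * a3) a2 ltac:(lia) ltac:(lia)).
    exists ((x + i * a3) mod a2), ((x + i * a3) / a2).
    unfold coin_count in L. repeat split; lia.
Qed.

Lemma coin_count_multiple_gt (a b j : Z) : 1 < a -> a < b -> 1 <= j ->
  j + 1 <= coin_count a (j * b).
Proof.
  intros Ha Hb Hj. unfold coin_count.
  pose proof (Z.div_mod (j * b) a ltac:(lia)).
  pose proof (Z.mod_pos_bound (j * b) a ltac:(lia)).
  assert (j <= j * b / a) by (apply Z.div_le_lower_bound; nia).
  assert (j * b <> j * a) by nia.
  destruct (Z.eq_dec (j * b / a) j) as [E | E]; [rewrite E in * |]; lia.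
Qed.

(** * Pigeonhole and packing of intervals in the cyclic group Z/m *)

Lemma residues_pigeonhole (A : Type) (m : Z) (key : A -> Z) (l : list A) :
  0 < m -> NoDup l ->
  (forall u v, In u l -> In v l -> (m | key u - key v) -> u = v) ->
  Z.of_nat (length l) <= m.
Proof.
  intros Hm Hl Hinj.
  assert (N : NoDup (map (fun u => key u mod m) l)).
  { apply NoDup_map_NoDup_ForallPairs; [| exact Hl].
    intros u v Hu Hv E. apply Hinj; [exact Hu | exact Hv |].
    apply Z.mod_divide; [lia |]. apply Z.cong_iff_0. exact E. }
  apply NoDup_incl_length with (l' := map Z.of_nat (seq 0 (Z.to_nat m))) in N.
  - rewrite !length_map, length_seq in N. lia.
  - intros z Hz. apply in_map_iff in Hz as (u & <- & _).
    pose proof (Z.mod_pos_bound (key u) m Hm).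
    apply in_map_iff. exists (Z.to_nat (key u mod m)).
    rewrite in_seq. lia.
Qed.

Definition Zrange (lo hi : Z) : list Z :=
  map (fun i => lo + Z.of_nat i) (seq 0 (Z.to_nat (hi - lo))).

Lemma in_Zrange (lo hi z : Z) : In z (Zrange lo hi) <-> lo <= z < hi.
Proof.
  unfold Zrange. rewrite in_map_iff. split.
  - intros (i & <- & H). apply in_seq in H. lia.
  - intros H. exists (Z.to_nat (z - lo)). rewrite in_seq. lia.
Qed.

Lemma NoDup_Zrange (lo hi : Z) : NoDup (Zrange lo hi).
Proof.
  apply FinFun.Injective_map_NoDup; [intros i j; lia | apply seq_NoDup].
Qed.

Lemma length_Zrange (lo hi : Z) : lo <= hi ->
  Z.of_nat (length (Zrange lo hi)) = hi - lo.
Proof. intros H. unfold Zrange. rewrite length_map, length_seq. lia. Qed.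

Lemma NoDup_list_prod (A B : Type) (l : list A) (l' : list B) :
  NoDup l -> NoDup l' -> NoDup (list_prod l l').
Proof.
  intros Hl Hl'. induction Hl as [| x l Hx _ IH]; simpl; [constructor |].
  apply NoDup_app; [| exact IH |].
  - apply Injective_map_NoDup; [congruence | exact Hl'].
  - intros [u v] H1 H2. apply in_map_iff in H1 as (v' & E & _).
    apply in_prod_iff in H2 as [H2 _]. congruence.
Qed.

(* Two intervals of a circle meet only if the start of one lies in the other,
   so it suffices to compare starting points. *)
Lemma interval_packing (m rho : Z) (l : list (Z * Z)) :
  0 < m -> NoDup l ->
  (forall j t j' t', In (j, t) l -> In (j', t') l -> t' <= t ->
    (m | (j' - j) * rho - (t - t')) -> j = j' /\ t = t') ->
  Z.of_nat (length l) <= m.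
Proof.
  intros Hm Hl H.
  apply residues_pigeonhole with (key := fun u => fst u * rho + snd u);
    [exact Hm | exact Hl |].
  intros [j t] [j' t'] Hu Hv [z D]; simpl in D.
  destruct (Z_le_gt_dec t' t) as [L | L].
  - destruct (H j t j' t' Hu Hv L) as [-> ->]; [exists (- z); lia | reflexivity].
  - destruct (H j' t' j t Hv Hu ltac:(lia)) as [-> ->];
      [exists z; lia | reflexivity].
Qed.

Lemma not_divide_small (m z : Z) : 0 < z < m -> ~ (m | z).
Proof. intros H D. apply Z.divide_pos_le in D; lia. Qed.

(* The interval of length [w] at a point with [j < 0] stays free because a point
   of index [T + d] is the point of index [d] shifted by [w]. *)
Lemma packing_return (m rho c w I T : Z) :
  1 <= I -> 2 <= T -> 0 <= c < m -> 1 <= w <= c ->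
  (m | T * rho - w) ->
  (forall j t, 1 <= j < T -> 0 <= t <= c -> ~ (m | j * rho - t)) ->
  (forall j t, 1 <= j < I -> 0 <= t <= c -> ~ (m | j * rho + t)) ->
  c + (I - 1) * w + T <= m.
Proof.
  intros HI HT Hc Hw [zT HwT] Hpos Hneg.
  assert (Hret : forall j t, 1 <= j < I + T -> 0 <= t < w ->
            ~ (m | j * rho - t)).
  { intros j t Hj Ht [z D].
    destruct (Z_lt_le_dec j T) as [L | L].
    - apply (Hpos j t); [lia | lia | exists z; exact D].
    - destruct (Z.eq_dec j T) as [-> | N].
      + apply (not_divide_small m (w - t)); [lia |]. exists (z - zT). lia.
      + apply (Hneg (j - T) (w - t)); [lia | lia |]. exists (z - zT). lia. }
  set (l1 := list_prod (Zrange (1 - I) 0) (Zrange 0 w)).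
  set (l2 := list_prod (Zrange 0 1) (Zrange 0 (c + 1))).
  set (l3 := list_prod (Zrange 1 T) (Zrange 0 1)).
  assert (In1 : forall j t, In (j, t) l1 <-> 1 - I <= j < 0 /\ 0 <= t < w)
    by (intros; unfold l1; rewrite in_prod_iff, !in_Zrange; reflexivity).
  assert (In2 : forall j t, In (j, t) l2 <-> 0 <= j < 1 /\ 0 <= t < c + 1)
    by (intros; unfold l2; rewrite in_prod_iff, !in_Zrange; reflexivity).
  assert (In3 : forall j t, In (j, t) l3 <-> 1 <= j < T /\ 0 <= t < 1)
    by (intros; unfold l3; rewrite in_prod_iff, !in_Zrange; reflexivity).
  assert (N : NoDup (l1 ++ l2 ++ l3)).
  { apply NoDup_app; [| apply NoDup_app |];
      try (apply NoDup_list_prod; apply NoDup_Zrange).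
    - intros [j t] H1 H2. apply In2 in H1. apply In3 in H2. lia.
    - intros [j t] H1 H2. apply In1 in H1.
      apply in_app_iff in H2 as [H2 | H2]; [apply In2 in H2 | apply In3 in H2];
        lia. }
  apply (interval_packing m rho) in N; [| lia |].
  - rewrite !length_app in N. unfold l1, l2, l3 in N.
    rewrite !length_prod, !Nat2Z.inj_add, !Nat2Z.inj_mul, !length_Zrange in N
      by lia.
    lia.
  - intros j t j' t' Hu Hv L [z D].
    rewrite !in_app_iff, In1, In2, In3 in Hu, Hv.
    destruct (Z.eq_dec j j') as [-> | Nj].
    { split; [reflexivity |].
      destruct (Z.eq_dec t t') as [E | Nt]; [exact E |].
      exfalso. apply (not_divide_small m (t - t')); [lia |].
      exists (- z). lia. }
    exfalso.
    destruct (Z_lt_le_dec j' j) as [Lj | Lj].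
    + destruct (Z.eq_dec t t') as [-> | Nt].
      * apply (Hret (j - j') 0); [lia | lia |]. exists (- z). lia.
      (* Here [t > t' >= 0], which excludes [l3]; hence [j <= 0] and the index gap stays below
         [I]. *)
      * apply (Hneg (j - j') (t - t')); [lia | lia |]. exists (- z). lia.
    + destruct (Z_lt_le_dec j 0).
      * apply (Hret (j' - j) (t - t')); [lia | lia |]. exists z. lia.
      * apply (Hpos (j' - j) (t - t')); [lia | lia |]. exists z. lia.
Qed.

(** Intervals of length [c + 1] at indices 0 and 1, and single points at indices 2 to [T - 1], are
    disjoint. *)
Lemma packing_two_steps (m rho c T : Z) :
  2 <= T -> 0 <= c < m ->
  (forall j t, 1 <= j < T -> 0 <= t <= c -> ~ (m | j * rho - t)) ->
  (forall t, 0 <= t <= c -> ~ (m | rho + t)) ->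
  2 * c + T <= m.
Proof.
  intros HT Hc Hpos Hneg.
  set (l1 := list_prod (Zrange 0 2) (Zrange 0 (c + 1))).
  set (l2 := list_prod (Zrange 2 T) (Zrange 0 1)).
  assert (In1 : forall j t, In (j, t) l1 <-> 0 <= j < 2 /\ 0 <= t < c + 1)
    by (intros; unfold l1; rewrite in_prod_iff, !in_Zrange; reflexivity).
  assert (In2 : forall j t, In (j, t) l2 <-> 2 <= j < T /\ 0 <= t < 1)
    by (intros; unfold l2; rewrite in_prod_iff, !in_Zrange; reflexivity).
  assert (N : NoDup (l1 ++ l2)).
  { apply NoDup_app; try (apply NoDup_list_prod; apply NoDup_Zrange).
    intros [j t] H1 H2. apply In1 in H1. apply In2 in H2. lia. }
  apply (interval_packing m rho) in N; [| lia |].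
  - rewrite !length_app in N. unfold l1, l2 in N.
    rewrite !length_prod, !Nat2Z.inj_add, !Nat2Z.inj_mul, !length_Zrange in N
      by lia.
    lia.
  - intros j t j' t' Hu Hv L [z D].
    rewrite !in_app_iff, In1, In2 in Hu, Hv.
    destruct (Z.eq_dec j j') as [-> | Nj].
    { split; [reflexivity |].
      destruct (Z.eq_dec t t') as [E | Nt]; [exact E |].
      exfalso. apply (not_divide_small m (t - t')); [lia |].
      exists (- z). lia. }
    exfalso.
    destruct (Z_lt_le_dec j' j) as [Lj | Lj].
    + destruct (Z.eq_dec t t') as [-> | Nt].
      * apply (Hpos (j - j') 0); [lia | lia |]. exists (- z). lia.
      * apply (Hneg (t - t')); [lia |]. exists (- z).
        replace j with 1 in D by lia. replace j' with 0 in D by lia. lia.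
    + apply (Hpos (j' - j) (t - t')); [lia | lia |]. exists z. lia.
Qed.

(** * From packings to the bound for the orbit of multiples of [b] *)

Lemma coin_count_multiple_cong (a b j : Z) : 1 < a ->
  (a - 1 | coin_count a (j * b) - j - j * (b - 1)).
Proof.
  intros Ha.
  replace (coin_count a (j * b) - j - j * (b - 1))
    with (coin_count a (j * b) - j * b) by lia.
  apply coin_count_cong. exact Ha.
Qed.

(** Each step raises the floor by at least 1 and at most [b / a + 1]. Counting back from [T] gives
    [2 * b / a <= w + 1]; counting forward to [I] then costs at most [w] per step. *)
Lemma floor_growth (a b T I w : Z) :
  1 < a -> a < b -> 2 <= T -> 2 <= I ->
  coin_count a (T * b) = T + w -> (T * b) mod a <> 0 ->
  I * b / a <= (I - 1) * w + 1.
Proof.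
  intros Ha Hb HT HI Hw Hm.
  pose proof (Z.mod_pos_bound (T * b) a ltac:(lia)).
  pose proof (Z.div_mod (T * b) a ltac:(lia)) as DT.
  unfold coin_count in Hw.
  assert (F2T : 2 * b / a + (T - 2) <= T * b / a).
  { rewrite <- Z.div_add by lia. apply Z.div_le_mono; nia. }
  pose proof (Z.div_mod b a ltac:(lia)) as Db.
  pose proof (Z.mod_pos_bound b a ltac:(lia)).
  assert (K1 : 1 <= b / a) by (apply Z.div_le_lower_bound; lia).
  assert (F12 : 2 * (b / a) <= 2 * b / a) by (apply Z.div_le_lower_bound; lia).
  assert (FI : I * b / a <= 2 * b / a + (I - 2) * (b / a + 1)).
  { rewrite <- Z.div_add by lia. apply Z.div_le_mono; nia. }
  assert (Kw : b / a + 1 <= w).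
  { destruct (Z_le_gt_dec 2 (b / a)); [lia |].
    destruct (Z_le_gt_dec 2 w); [lia |].
    (* With [b / a = 1] and [w <= 1] the remainder of [T * b] would be at most 1, but
       [T * (b - a) >= 2]. *)
    assert (T * b / a = T) as E by lia. rewrite E in DT. nia. }
  nia.
Qed.

(* For [I = 1] there is no point with [j < 0]; there the extra hypothesis puts
   [c + 1] in the orbit before time [T - 1], which frees a second interval of
   length [c + 1], at [j = 1]. *)
Lemma orbit_bound (a b c I T : Z) :
  1 < a -> a < b -> 0 <= I -> 2 <= T -> 0 <= c ->
  (forall j, 1 <= j < T -> c + 1 + j <= coin_count a (j * b) <= a - 2 + j) ->
  (forall j, 1 <= j < I -> coin_count a (j * b) <= a - 2 - c + j) ->
  coin_count a (T * b) <= c + T ->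
  (1 <= I -> (T * b) mod a <> 0) ->
  (I = 1 -> exists j, 1 <= j <= T - 2 /\ coin_count a (j * b) = c + 1 + j) ->
  c + I * b / a + T <= a.
Proof.
  intros Ha Hb HI HT Hc Hup Hdown Hret HTmod HI1.
  pose proof (fun j => coin_count_multiple_gt a b j Ha Hb) as Hgt.
  pose proof (fun j => coin_count_multiple_cong a b j Ha) as Hcong.
  assert (Hpos : forall j t, 1 <= j < T -> 0 <= t <= c ->
            ~ (a - 1 | j * (b - 1) - t)).
  { intros j t Hj Ht [z D]. destruct (Hcong j) as [z' D'].
    specialize (Hup j Hj).
    apply (not_divide_small (a - 1) (coin_count a (j * b) - j - t)); [lia |].
    exists (z + z'). lia. }
  assert (Hneg : forall j t, 1 <= j < I -> 0 <= t <= c ->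
            ~ (a - 1 | j * (b - 1) + t)).
  { intros j t Hj Ht [z D]. destruct (Hcong j) as [z' D'].
    specialize (Hdown j Hj). specialize (Hgt j).
    apply (not_divide_small (a - 1) (coin_count a (j * b) - j + t)); [lia |].
    exists (z + z'). lia. }
  pose proof (Hup 1 ltac:(lia)) as Hup1.
  pose proof (Hgt T ltac:(lia)) as HgtT.
  assert (Hw : (a - 1 | T * (b - 1) - (coin_count a (T * b) - T))).
  { destruct (Hcong T) as [z D]. exists (- z). lia. }
  destruct (Z.eq_dec I 0) as [-> | N0].
  { rewrite Z.mul_0_l, Z.div_0_l by lia.
    (* Index 1 replaces [I = 0]: there are no negative points and the term in [w] vanishes. *)
    pose proof (packing_return (a - 1) (b - 1) c (coin_count a (T * b) - T) 1 T
      ltac:(lia) HT ltac:(lia) ltac:(lia) Hw Hpos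
      ltac:(intros; lia)). lia. }
  destruct (Z.eq_dec I 1) as [-> | N1].
  - destruct (HI1 eq_refl) as (j & Hj & Ej).
    assert (2 * c + T <= a - 1).
    { apply (packing_two_steps (a - 1) (b - 1)); [lia | lia | exact Hpos |].
      intros t Ht D. destruct (Z.eq_dec t 0) as [-> | Nt].
      - apply (Hpos 1 0); [lia | lia |]. destruct D as [z D]. exists z. lia.
      (* One step of [- t] from the orbit value [c + 1] would land in [[0, c]] at time
         [j + 1 < T]. *)
      - destruct D as [z D]. destruct (Hcong j) as [z' D'].
        apply (Hpos (j + 1) (c + 1 - t)); [lia | lia |].
        exists (z - z'). lia. }
    assert (b / a <= c + 1).
    { assert (b / a + (T - 1) <= T * b / a).
      { rewrite <- Z.div_add by lia. apply Z.div_le_mono; nia. }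
      pose proof (Z.mod_pos_bound (T * b) a ltac:(lia)).
      unfold coin_count in Hret. lia. }
    rewrite Z.mul_1_l. lia.
  - pose proof (packing_return (a - 1) (b - 1) c (coin_count a (T * b) - T) I T
      ltac:(lia) HT ltac:(lia) ltac:(lia) Hw Hpos Hneg).
    pose proof (floor_growth a b T I (coin_count a (T * b) - T) Ha Hb HT
      ltac:(lia) ltac:(lia) (HTmod ltac:(lia))).
    lia.
Qed.

(** * Reduction of the stride generator conditions to the orbit bound *)

Theorem theorem1 (a2 a3 n p y q : Z) :
  1 < a2 -> a2 < a3 -> 0 <= p ->
  stride_generator a2 a3 n p ->
  is_break a2 a3 n p y ->
  ~ canonical_break a2 a3 n y ->
  break_order a2 a3 n y q ->
  n + q <= a2.
Proof.
  intros Ha Hb Hp (_ & Hcover & _ & _) (Hy & Hbreak) _ (Hq & Hgq & Hmin).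
  assert (Hpq : p + 2 <= q).
  { destruct (Z_lt_le_dec (p + 1) q); [lia |].
    exfalso. apply (Hbreak q); [lia | exact Hgq]. }
  assert (Hlow : forall i, 0 <= i < q -> n + i <= coin_count a2 (y + i * a3)).
  { intros i Hi. specialize (Hmin i Hi).
    rewrite has_gen_coin_count in Hmin by nia. lia. }
  assert (Hend : coin_count a2 (y + q * a3) <= n + q - 1).
  { rewrite has_gen_coin_count in Hgq by nia. lia. }
  assert (Hcov : forall x, 0 <= x < a3 ->
            exists i, 0 <= i <= p /\ coin_count a2 (x + i * a3) <= n + i).
  { intros x Hx. destruct (Hcover x Hx) as (i & Hi & G). exists i.
    rewrite has_gen_coin_count in G by nia. split; assumption. }
  clear Hcover Hbreak Hgq Hmin.
  (* Otherwise [y + a2] is covered, and dropping one coin [a2] makes [y] too cheap. *)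
  assert (Hytop : a3 - a2 <= y).
  { destruct (Z_lt_le_dec y (a3 - a2)); [exfalso | lia].
    destruct (Hcov (y + a2) ltac:(lia)) as (i & Hi & G).
    replace (y + a2 + i * a3) with (1 * a2 + (y + i * a3)) in G by lia.
    rewrite coin_count_shift in G by lia. specialize (Hlow i). lia. }
  assert (Hn : 1 <= n).
  { pose proof (Hlow 0 ltac:(lia)) as L0.
    assert (q <= coin_count a2 (y + q * a3)); [| lia].
    unfold coin_count.
    pose proof (Z.mod_pos_bound (y + q * a3) a2 ltac:(lia)).
    assert (q <= (y + q * a3) / a2) by (apply Z.div_le_lower_bound; nia). lia. }
  (* A unit coin in the greedy generation of [y + 1] could be dropped, making [y] too cheap; so the
     residue is 0. For [y = a3 - 1], order -1 gives [K = 0], and [1 <= n] supplies the bound. *)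
  assert (Hturn : exists i1 K, -1 <= i1 <= p /\ y + 1 + i1 * a3 = K * a2 /\
            K <= n + i1).
  { destruct (Z.eq_dec y (a3 - 1)) as [-> | Ny].
    - exists (-1), 0. lia.
    - destruct (Hcov (y + 1) ltac:(lia)) as (i & Hi & G).
      destruct (Z.eq_dec ((y + 1 + i * a3) mod a2) 0) as [E | E].
      + exists i, ((y + 1 + i * a3) / a2).
        pose proof (Z.div_mod (y + 1 + i * a3) a2 ltac:(lia)).
        unfold coin_count in G. lia.
      + exfalso. apply coin_count_pred in E; [| lia].
        replace (y + 1 + i * a3 - 1) with (y + i * a3) in E by lia.
        specialize (Hlow i). lia. }
  destruct Hturn as (i1 & K & Hi1 & EK & HK).
  assert (HKdiv : (i1 + 1) * a3 / a2 = K).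
  { symmetry. apply Z.div_unique with (r := (i1 + 1) * a3 - K * a2); lia. }
  (* Without a carry, adding [j * a3], which costs more than [j], would push the count at order [q]
     above [n + q]. *)
  assert (Hcarry : forall j, 1 <= j <= q ->
            (j * a3) mod a2 <> 0 /\ coin_count a2 (j * a3) <= a2 - 2 + j).
  { intros j Hj.
    pose proof (coin_count_multiple_gt a2 a3 j Ha Hb ltac:(lia)).
    pose proof (Hlow (q - j) ltac:(lia)).
    destruct (coin_count_add a2 (y + (q - j) * a3) (j * a3) Ha) as [E | [N E]];
      replace (y + (q - j) * a3 + j * a3) with (y + q * a3) in E by lia; lia. }
  assert (Hafter : forall j, coin_count a2 (y + (i1 + j) * a3)
            = K + coin_count a2 (j * a3 - 1)).
  { intros j. rewrite <- coin_count_shift by lia. f_equal. lia. }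
  enough (n - K + i1 + (i1 + 1) * a3 / a2 + (q - i1) <= a2) by lia.
  apply (orbit_bound a2 a3); try lia.
  - intros j Hj. destruct (Hcarry j ltac:(lia)) as [Hm Hu].
    pose proof (Hlow (i1 + j) ltac:(lia)) as L.
    rewrite Hafter, (coin_count_pred a2 (j * a3) Ha Hm) in L. lia.
  - intros j Hj. pose proof (Hlow (i1 - j) ltac:(lia)) as L.
    replace (y + (i1 - j) * a3) with (K * a2 - 1 - j * a3) in L by lia.
    rewrite coin_count_reflect in L by lia. lia.
  - pose proof (coin_count_pred_ge a2 ((q - i1) * a3) Ha).
    pose proof (Hafter (q - i1)) as E.
    replace (i1 + (q - i1)) with q in E by lia. lia.
  - intros HI. apply (Hcarry (q - i1)). lia.
  - intros HI. assert (i1 = 0) as -> by lia.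
    (* Covering [y] itself meets the lower bound with equality at some order [j <= p], and
       [p <= q - 2]. Order 0 is impossible: the count at order 1 would be at most that at order 0,
       hence at most [n]. *)
    destruct (Hcov y Hy) as (j & Hj & G).
    pose proof (Hlow j ltac:(lia)).
    destruct (Z.eq_dec j 0) as [-> | Nj].
    + exfalso.
      assert (E : coin_count a2 y = K + a2 - 2).
      { replace y with (K * a2 - 1 - 0) by lia.
        rewrite coin_count_reflect by lia.
        unfold coin_count at 1. rewrite Z.div_0_l, Z.mod_0_l by lia. lia. }
      rewrite Z.mul_0_l, Z.add_0_r in *.
      destruct (Hcarry 1 ltac:(lia)) as [Hm Hu].
      pose proof (Hlow 1 ltac:(lia)) as L.
      pose proof (Hafter 1) as E1.
      rewrite (coin_count_pred a2 (1 * a3) Ha Hm), Z.add_0_l in E1. lia.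
    + exists j. split; [lia |].
      destruct (Hcarry j ltac:(lia)) as [Hm Hu].
      pose proof (Hafter j) as E. rewrite (coin_count_pred a2 (j * a3) Ha Hm) in E.
      rewrite Z.add_0_l in E. lia.
Qed.
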